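(* Let $G$ be an edge-independent random graph on $[n]$ with edge probabilities $p_{ij}$, adjacency matrix $A$, expected adjacency matrix $\bar A=(p_{ij})_{i,j=1}^n$, and maximum expected degree $\Delta=\max_{1\le i\le n}\sum_{j=1}^n p_{ij}$. If $\Delta\gg \ln^4 n$, then almost surely $$|\lambda_i(A)-\lambda_i(\bar A)|\le (2+o(1))\sqrt{\Delta}\qquad\text{for each } 1\le i\le n.$$
   Context: Edge-independent random graph: for each $n$ we are given numbers $p_{ij}=p_{ji}\in[0,1]$ ($1\le i,j\le n$), not assumed equal and allowed to depend on $n$. The random graph $G$ has vertex set $[n]=\{1,\dots,n\}$, and each pair $\{i,j\}$, $i\le j$, is an edge with probability $p_{ij}$, independently of all other pairs (the case $i=j$ is a loop, contributing $1$ to the diagonal entry $A_{ii}$). $A$ is the adjacency matrix of $G$ and $\bar A=\mathrm{E}(A)$. For an $n\times n$ symmetric matrix $M$, $\lambda_1(M)\le\lambda_2(M)\le\dots\le\lambda_n(M)$ are its eigenvalues in non-decreasing order, with multiplicity. All quantities depend on $n$ and asymptotics are as $n\to\infty$: $f\gg g$ means $f(n)/g(n)\to\infty$, $o(1)$ is a deterministic quantity tending to $0$ (uniform in $i$), and ''almost surely'' means with probability tending to $1$ as $n\to\infty$. *)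

(* Defs.v *)
From HB Require Import structures.
From mathcomp Require Import all_boot all_order all_algebra.
From mathcomp Require Import polyrcf complex.
From mathcomp Require Import all_classical all_reals all_analysis.

Set Implicit Arguments.
Unset Strict Implicit.
Unset Printing Implicit Defensive.

Import Order.TTheory GRing.Theory Num.Theory.
Import numFieldNormedType.Exports.

Local Open Scope ring_scope.

Lemma char_poly_conj (F : fieldType) n (P D : 'M[F]_n) :
  P \in unitmx -> char_poly (invmx P *m D *m P) = char_poly D.
Proof.
move=> Pu; pose Q := map_mx polyC P; pose Q' := map_mx polyC (invmx P).
have Q'Q : Q' *m Q = 1%:M by rewrite -map_mxM mulVmx // map_mx1.
rewrite /char_poly (_ : char_poly_mx _ = Q' *m char_poly_mx D *m Q); last first.
  rewrite /char_poly_mx mulmxBr mulmxBl -!map_mxM; congr (_ - _).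
  by rewrite mul_mx_scalar -scalemxAl Q'Q scalemx1.
by rewrite !det_mulmx mulrC mulrA -det_mulmx (mulmx1C Q'Q) det1 mul1r.
Qed.

Section Eigenvalues.
Variable R : rcfType.
Implicit Types (n : nat).

(* Eigenvalues are counted with their algebraic multiplicity. *)
Definition eigvals n (M : 'M[R]_n) : seq R :=
  sort <=%R (flatten [seq nseq (mup x (char_poly M)) x
                     | x <- rootsR (char_poly M)]).

(* Indices start from 0: [eigval M i] is the (i+1)-st smallest eigenvalue. *)
Definition eigval n (M : 'M[R]_n) (i : 'I_n) : R := (eigvals M)`_i.

Lemma sorted_eigvals n (M : 'M[R]_n) : sorted <=%R (eigvals M).
Proof. exact/sort_sorted/le_total. Qed.

Lemma perm_eigvals n (M : 'M[R]_n) (s : seq R) :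
  char_poly M = \prod_(x <- s) ('X - x%:P) -> perm_eq (eigvals M) s.
Proof.
move=> Ms; rewrite perm_sort.
have M0 : char_poly M != 0 by rewrite monic_neq0 ?char_poly_monic.
have mem_rts x : (x \in rootsR (char_poly M)) = (x \in s).
  by rewrite -roots_on_rootsR //= Ms root_prod_XsubC.
apply/allP => x _ /=; rewrite count_flatten -map_comp.
rewrite (eq_map (g := fun y => if y == x then count_mem x s else 0%N)); last first.
  move=> y /=; rewrite count_nseq /=.
  by have [->|_] := eqVneq y x; rewrite ?mul0n // mul1n Ms mu_prod_XsubC.
have : uniq (rootsR (char_poly M)).
  exact: (sorted_uniq lt_trans ltxx (sorted_roots _ _ _)).
rewrite sumnE big_map -big_mkcond /= big_const_seq iter_addn addn0 => rts_uniq.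
rewrite (count_uniq_mem x rts_uniq) mem_rts.
by have [_|/count_memPn ->] := boolP (x \in s); rewrite ?muln1.
Qed.

Lemma char_poly_eigvals n (M : 'M[R]_n) :
  M^T = M -> char_poly M = \prod_(x <- eigvals M) ('X - x%:P).
Proof.
move=> Msym; pose c := real_complex R; pose A := map_mx c M.
have Aherm : A \is hermsymmx.
  apply: realsym_hermsym.
    by apply/is_hermitianmxP; rewrite expr0 scale1r map_mx_id // map_trmx Msym.
  by apply/mxOverP => i j; rewrite mxE; apply/complex_realP; exists (M i j).
have /orthomx_spectralP AE := hermitian_normalmx Aherm.
have /mxOverP dreal := hermitian_spectral_diag_real Aherm.
pose s := [seq complex.Re (spectral_diag A 0 i) | i <- enum 'I_n].
have AP : char_poly A = \prod_(x <- s) ('X - (c x)%:P).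
  rewrite AE char_poly_conj ?spectral_unit // char_poly_trig ?diag_mx_is_trig //.
  rewrite big_map -big_enum /=; apply: eq_bigr => i _.
  rewrite mxE eqxx mulr1n; have /complex_realP[x ->] := dreal 0 i.
  by [].
have Ms : char_poly M = \prod_(x <- s) ('X - x%:P).
  apply: (map_poly_inj c); rewrite map_char_poly AP rmorph_prod.
  by apply: eq_bigr => x _; rewrite rmorphB /= map_polyX map_polyC.
by rewrite {1}Ms; apply/perm_big; rewrite perm_sym perm_eigvals.
Qed.

Lemma size_eigvals n (M : 'M[R]_n) : M^T = M -> size (eigvals M) = n.
Proof.
move=> /char_poly_eigvals /(congr1 (fun q : {poly R} => size q)).
by rewrite size_char_poly size_prod_XsubC => -[].
Qed.

End Eigenvalues.

(* The possible edges on the vertex set ['I_n], loops included: an unordered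
   pair {i, j} is represented by (i, j) with i <= j. *)
Definition edge n := {e : 'I_n * 'I_n | (e.1 <= e.2)%N}.

Section RandomGraph.
Variables (R : realType) (n : nat).
Implicit Types (p : 'M[R]_n) (G : {set edge n}) (i j : 'I_n).

Definition edge_prob p (e : edge n) : R := p (val e).1 (val e).2.

(* The law of the random graph: the product of the Bernoulli laws of the
   individual edges. *)
Definition graph_prob p G : R :=
  \prod_(e : edge n) (if e \in G then edge_prob p e else 1 - edge_prob p e).

Definition Pr p (E : pred {set edge n}) : R :=
  \sum_(G : {set edge n} | E G) graph_prob p G.

Definition joined G i j : bool :=
  [exists e in G, (val e == (i, j)) || (val e == (j, i))].

Definition adj G : 'M[R]_n := \matrix_(i, j) (joined G i j)%:R.

Definition max_degree p : R := \big[Num.max/0]_(i < n) \sum_(j < n) p i j.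

Lemma graph_prob_ge0 p G :
  (forall i j, 0 <= p i j <= 1) -> 0 <= graph_prob p G.
Proof.
move=> p01; apply: prodr_ge0 => e _; have /andP[p0 p1] := p01 (val e).1 (val e).2.
by case: ifP => _; rewrite ?subr_ge0.
Qed.

(* Mutual independence of the edges, with the prescribed probabilities. *)
Lemma Pr_edges p (S : {set edge n}) :
  Pr p (fun G => S \subset G) = \prod_(e in S) edge_prob p e.
Proof.
transitivity (\prod_(e : edge n)
    (edge_prob p e + (if e \in S then 0 else 1 - edge_prob p e))).
  rewrite bigA_distr /Pr big_mkcond; apply: eq_bigr => G _.
  case: ifPn => [/fintype.subsetP SG|/subsetPn[e eS eG]].
    apply: eq_bigr => e _; case: ifPn => // eG.
    by rewrite ifN //; apply: contra eG; apply: SG.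
  by rewrite (bigD1 e) //= (negPf eG) eS mul0r.
rewrite [RHS]big_mkcond; apply: eq_bigr => e _.
by case: ifP => _; rewrite ?addr0 // addrC subrK.
Qed.

Lemma Pr_total p : Pr p predT = 1.
Proof.
have := Pr_edges p finset.set0; rewrite big_set0 => <-.
by apply: eq_bigl => G; rewrite finset.sub0set.
Qed.

Lemma expectation_adj p i j : (forall i j, p i j = p j i) ->
  \sum_(G : {set edge n}) graph_prob p G * adj G i j = p i j.
Proof.
move=> psym; wlog ij : i j / (i <= j)%N => [wl|].
  have [/wl //|/ltnW/wl ji] := leqP i j; rewrite psym -ji.
  apply: eq_bigr => G _; rewrite !mxE; congr (_ * (nat_of_bool _)%:R).
  by apply: eq_existsb => e; rewrite orbC.
pose e : edge n := exist _ (i, j) ij.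
have joinedE G : joined G i j = (e \in G).
  apply/existsP/idP => [[f /andP[fG fij]]|eG]; last by exists e; rewrite eG eqxx.
  rewrite (_ : e = f) //; apply: val_inj; case: f fij {fG} => -[a b] /= ab.
  case/orP=> /eqP[ai bj] //; first by rewrite ai bj.
  by rewrite ai bj in ab *; congr pair; apply/val_inj/eqP; rewrite eqn_leq ij ab.
have := Pr_edges p [set e]%SET; rewrite big_set1 /edge_prob /= => <-.
rewrite /Pr [RHS]big_mkcond; apply: eq_bigr => G _.
by rewrite mxE joinedE finset.sub1set; case: ifP => _; rewrite ?mulr1 ?mulr0.
Qed.

End RandomGraph.

Arguments adj {R n} G.

(* Main.v *)
Require Import Defs.
From mathcomp Require Import all_boot all_order all_algebra.
From mathcomp Require Import all_fingroup complex zify ring lra.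
From mathcomp Require Import all_classical all_reals all_analysis.

Set Implicit Arguments.
Unset Strict Implicit.
Unset Printing Implicit Defensive.

Import Order.TTheory GRing.Theory Num.Theory.
Import numFieldNormedType.Exports.

Local Open Scope classical_set_scope.
Local Open Scope ring_scope.

(** Write X for the centered adjacency matrix A - Abar, Delta for the maximum
expected degree and s for its square root.  By Weyl's inequality each
eigenvalue moves by at most the largest modulus of an eigenvalue of X, and for
even k the k-th power of this modulus is at most tr X^k.  So it suffices, by
Markov's inequality, to show
  E tr X^k <= n (2 s + (k+1)^2)^k                                        (1)
and to choose k with k >> ln n (which kills the factor n after taking k-th
roots) and k^2 << s (which makes the sum in the bracket (2 + o(1)) s).  Both are
possible exactly because Delta >> ln^4 n.

The matrix power is a sum over walks, and independence makes the expectation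
of the monomial of a walk a product over its distinct edges.  This product
vanishes if some edge is used exactly once; otherwise an edge e contributes at
most p_e, because all moments of order at least 2 of a centered Bernoulli
variable are at most p_e in modulus, and also at most 1.  Reading a walk from
left to right, each step is of one of three types:
- opening: it discovers a new vertex; its edge is now open and is charged
  p_e.  The choice of the vertex costs a factor at most Delta in total.
- closing: it uses an open edge for the second time.
- neutral: any other step; it ends at one of at most k+1 known vertices.
A surviving walk leaves no edge open.  If every closing step were forced by
the current state, (1) would follow, with k+1 in place of (k+1)^2, by counting
weighted Motzkin paths: the height is the number of open edges, up steps weigh
Delta, down steps 1 and level steps k+1.

A closing step is not forced if the current vertex carries several open
edges.  The excess of a state measures the deviation from the situation in
which the open edges form a path from the root to the current vertex.  It is
not increased by opening steps, grows by at most 1 with a neutral step, and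
drops by at least 1 with a closing step that had a choice.  Hence a weight
(k+1)^excess pays for these choices, at the price of an additional factor k+1
for every neutral step ([walk_weight_le]).  No walk is ever enumerated: both
the expectation ([expect_walk_le]) and the weights obey the same recursion on
the number of steps. *)

(** * Eigenvalues of real symmetric matrices *)

Section Spectral.
Variable R : rcfType.
Local Notation C := R[i].
Local Open Scope sesquilinear_scope.
Implicit Types n : nat.
Local Notation toC := (real_complex R).

Definition Cquad n (M : 'M[R]_n) (v : 'rV[C]_n) : C :=
  (v *m map_mx toC M *m v^t*) 0 0.

Definition eigval_diag n (M : 'M[R]_n) : 'M[C]_n :=
  diag_mx (\row_i toC (eigval M i)).

(** The spectral theorem, with the eigenvectors permuted so that the diagonal is
sorted; the order of the eigenvalues matters for Weyl's inequality. *)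
Lemma symmetric_diagonalization n (M : 'M[R]_n) : M^T = M ->
  exists2 P : 'M[C]_n, P \is unitarymx &
    map_mx toC M = P^t* *m eigval_diag M *m P.
Proof.
move=> Msym; pose A := map_mx toC M.
have Aherm : A \is hermsymmx.
  apply: realsym_hermsym.
    by apply/is_hermitianmxP; rewrite expr0 scale1r map_mx_id // map_trmx Msym.
  by apply/mxOverP => i j; rewrite mxE; apply/complex_realP; exists (M i j).
have /orthomx_spectralP AE := hermitian_normalmx Aherm.
have /mxOverP dreal := hermitian_spectral_diag_real Aherm.
pose d i := complex.Re (spectral_diag A 0 i).
have dE i : spectral_diag A 0 i = toC (d i).
  by rewrite /d; have /complex_realP[x ->] := dreal 0 i.
have AP : char_poly A = \prod_(x <- [tuple d i | i < n]) ('X - (toC x)%:P).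
  rewrite AE char_poly_conj ?spectral_unit // char_poly_trig ?diag_mx_is_trig //.
  rewrite big_map -big_enum /=; apply: eq_bigr => i _.
  by rewrite mxE eqxx mulr1n dE.
have /perm_eigvals/tuple_permP[s Ms] :
    char_poly M = \prod_(x <- [tuple d i | i < n]) ('X - x%:P).
  apply: (map_poly_inj toC); rewrite map_char_poly AP rmorph_prod.
  by apply: eq_bigr => x _; rewrite rmorphB /= map_polyX map_polyC.
have eigE i : eigval M i = d (s i).
  rewrite /eigval Ms (nth_map i) ?size_enum_ord // nth_ord_enum.
  by rewrite !tnth_mktuple.
exists (row_perm s (spectralmx A)).
  apply/unitarymxP/matrixP => i j; rewrite !mxE.
  transitivity ((spectralmx A *m (spectralmx A)^t*) (s i) (s j)).
    by rewrite mxE; apply: eq_bigr => k _; rewrite !mxE.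
  by have /unitarymxP -> := spectral_unitarymx A; rewrite mxE (inj_eq perm_inj).
rewrite -/A {1}AE invmx_unitary ?spectral_unitarymx //.
apply/matrixP => i j; rewrite !mxE (reindex_inj (@perm_inj _ s)).
apply: eq_bigr => k _; rewrite !mul_mx_diag !mxE.
by rewrite dE eigE.
Qed.

Lemma rayleigh_expansion n (M : 'M[R]_n) : M^T = M ->
  exists Q : 'M[C]_n, forall v : 'rV_n,
    Cquad M v = \sum_j toC (eigval M j) * `|(v *m Q) 0 j| ^+ 2 /\
    (v *m v^t*) 0 0 = \sum_j `|(v *m Q) 0 j| ^+ 2.
Proof.
move=> /symmetric_diagonalization[P Pu ME]; exists (P^t*) => v.
have normE (w : 'rV[C]_n) D : (w *m diag_mx D *m w^t*) 0 0 =
    \sum_j D 0 j * `|w 0 j| ^+ 2.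
  rewrite mxE; apply: eq_bigr => j _; rewrite mul_mx_diag !mxE normCK.
  by rewrite mulrA [D 0 j * _]mulrC.
have wE : (v *m P^t*)^t* = P *m v^t*.
  by rewrite trmx_mul map_mxM; congr (_ *m _); apply: trmxCK.
have PPv : v *m P^t* *m P = v.
  by rewrite -mulmxA -invmx_unitary // mulVmx ?mulmx1 // unitarymx_unit.
split.
  transitivity ((v *m P^t* *m eigval_diag M *m (v *m P^t*)^t*) 0 0).
    by rewrite /Cquad ME wE !mulmxA.
  by rewrite normE; apply: eq_bigr => j _; rewrite mxE.
rewrite -{1}PPv -mulmxA -wE mxE.
by apply: eq_bigr => j _; rewrite !mxE normCK.
Qed.

Lemma Csqnorm_gt0 n (v : 'rV[C]_n) : v != 0 -> 0 < (v *m v^t*) 0 0.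
Proof.
have -> : (v *m v^t*) 0 0 = \sum_j `|v 0 j| ^+ 2.
  by rewrite mxE; apply: eq_bigr => j _; rewrite !mxE normCK.
move=> /rV0Pn[j vj]; rewrite (bigD1 j) //=.
by rewrite ltr_pwDl ?exprn_gt0 ?normr_gt0 // sumr_ge0 // => i _; rewrite exprn_ge0.
Qed.

Lemma CquadB n (A B : 'M[R]_n) v : Cquad (A - B) v = Cquad A v - Cquad B v.
Proof. by rewrite /Cquad map_mxB mulmxBr mulmxBl !mxE. Qed.

Lemma eigval_le_mono n (M : 'M[R]_n) (i j : 'I_n) : M^T = M ->
  (i <= j)%N -> eigval M i <= eigval M j.
Proof.
move=> Msym ij; apply: (sorted_leq_nth le_trans le_refl) => //.
- exact: sorted_eigvals.
- by rewrite inE size_eigvals.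
- by rewrite inE size_eigvals.
Qed.

(** The subspace spanned by the eigenvectors of A for its eigenvalues of index
at least i and the one spanned by those of B for index at most i have
dimensions adding up to n + 1, so they share a nonzero v.  On v the form of A
is at least [eigval A i] and that of B at most [eigval B i]. *)
Lemma eigval_le_of_quad n (A B : 'M[R]_n) rho (i : 'I_n) :
  A^T = A -> B^T = B ->
  (forall v, Cquad (A - B) v <= toC rho * (v *m v^t*) 0 0) ->
  eigval A i - eigval B i <= rho.
Proof.
move=> Asym Bsym ABrho.
have [QA QAE] := rayleigh_expansion Asym; have [QB QBE] := rayleigh_expansion Bsym.
(* A vector in the intersection satisfies n - 1 linear equations: its
   A-coordinates before i and its B-coordinates after i vanish.  They are the
   columns of Q, whose column i is zero, so that Q is singular. *)
pose Q := \matrix_(a, j)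
  if (j < i)%N then QA a j else if (i < j)%N then QB a j else 0.
have /det0P[v v0 vQ] : \det Q == 0.
  rewrite (expand_det_col _ i) big1 // => a _.
  by rewrite mxE ltnn mul0r.
have vA (j : 'I_n) : (j < i)%N -> (v *m QA) 0 j = 0.
  move=> ji; have /matrixP/(_ 0 j) := vQ; rewrite !mxE => vQj; rewrite -[RHS]vQj.
  by apply: eq_bigr => a _; rewrite mxE ji.
have vB (j : 'I_n) : (i < j)%N -> (v *m QB) 0 j = 0.
  move=> ij; have /matrixP/(_ 0 j) := vQ; rewrite !mxE => vQj; rewrite -[RHS]vQj.
  by apply: eq_bigr => a _; rewrite mxE ij ltnNge ltnW.
have Alow : toC (eigval A i) * (v *m v^t*) 0 0 <= Cquad A v.
  have [-> ->] := QAE v; rewrite mulr_sumr; apply: ler_sum => j _.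
  have [/vA->|ij] := ltnP j i; first by rewrite normr0 expr0n !mulr0.
  by rewrite ler_wpM2r ?exprn_ge0 // lecR eigval_le_mono.
have Bup : Cquad B v <= toC (eigval B i) * (v *m v^t*) 0 0.
  have [-> ->] := QBE v; rewrite mulr_sumr; apply: ler_sum => j _.
  have [/vB->|ij] := ltnP i j; first by rewrite normr0 expr0n !mulr0.
  by rewrite ler_wpM2r ?exprn_ge0 // lecR eigval_le_mono.
rewrite -lecR -(ler_pM2r (Csqnorm_gt0 v0)) rmorphB mulrBl.
by apply: le_trans (ABrho v); rewrite CquadB lerB.
Qed.

Lemma weyl_perturbation n (A B : 'M[R]_n) rho : A^T = A -> B^T = B ->
  (forall j, `|eigval (A - B) j| <= rho) ->
  forall i, `|eigval A i - eigval B i| <= rho.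
Proof.
move=> Asym Bsym ABrho i.
have ABsym : (A - B)^T = A - B by rewrite linearB /= Asym Bsym.
have [Q QE] := rayleigh_expansion ABsym.
rewrite ler_norml lerNl opprB; apply/andP; split; apply: eigval_le_of_quad => // v.
  rewrite CquadB -opprB -CquadB; have [-> ->] := QE v.
  rewrite mulr_sumr -sumrN; apply: ler_sum => j _.
  rewrite -mulNr ler_wpM2r ?exprn_ge0 // -rmorphN lecR.
  by rewrite lerNl; have := ABrho j; rewrite ler_norml => /andP[].
have [-> ->] := QE v; rewrite mulr_sumr; apply: ler_sum => j _.
rewrite ler_wpM2r ?exprn_ge0 // lecR.
by have := ABrho j; rewrite ler_norml => /andP[].
Qed.

Lemma mxtrace_exp_eigval n (M : 'M[R]_n) k : M^T = M ->
  \tr (M ^+ k) = \sum_j eigval M j ^+ k.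
Proof.
move=> /symmetric_diagonalization[P Pu ME].
have expE : map_mx toC (M ^+ k) =
    P^t* *m diag_mx (\row_j toC (eigval M j ^+ k)) *m P.
  elim: k => [|k IH].
    rewrite expr0 map_mx1 (_ : diag_mx _ = 1%:M); last first.
      by apply/matrixP => i j; rewrite !mxE expr0.
    by rewrite mulmx1 -invmx_unitary // mulVmx // unitarymx_unit.
  have mulE (D1 D2 : 'M[C]_n) :
      (P^t* *m D1 *m P) *m (P^t* *m D2 *m P) = P^t* *m (D1 *m D2) *m P.
    by rewrite !mulmxA mulmxtVK.
  have -> : map_mx toC (M ^+ k.+1) = map_mx toC M *m map_mx toC (M ^+ k).
    by rewrite -map_mxM exprS.
  have rowE : \row_i ((\row_j toC (eigval M j)) 0 i
      * (\row_j toC (eigval M j ^+ k)) 0 i) = \row_j toC (eigval M j ^+ k.+1).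
    by apply/rowP => j; rewrite !mxE exprS rmorphM.
  by rewrite IH ME mulE /eigval_diag mulmx_diag rowE.
apply: (fmorph_inj toC); rewrite -trace_map_mx expE mxtrace_mulC mulmxA.
have /unitarymxP -> := Pu; rewrite mul1mx mxtrace_diag rmorph_sum.
by apply: eq_bigr => j _; rewrite mxE.
Qed.

Lemma eigval_exp_le_trace n (M : 'M[R]_n) k (i : 'I_n) : M^T = M -> ~~ odd k ->
  eigval M i ^+ k <= \tr (M ^+ k).
Proof.
move=> Msym kE; rewrite mxtrace_exp_eigval // (bigD1 i) //= lerDl.
by apply: sumr_ge0 => j _; rewrite exprn_even_ge0.
Qed.

End Spectral.

(** * Unordered pairs of vertices *)

Section UnorderedPairs.
Variable n : nat.
Implicit Types (i j v w x y : 'I_n) (O : {set edge n}).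

Lemma sorted_pair_leq i j (e := if (i <= j)%N then (i, j) else (j, i)) :
  (e.1 <= e.2)%N.
Proof. by rewrite /e; case: (leqP i j) => //= /ltnW. Qed.

Definition upair i j : edge n :=
  exist (fun e : 'I_n * 'I_n => (e.1 <= e.2)%N) _ (sorted_pair_leq i j).

Lemma upairC i j : upair i j = upair j i.
Proof.
by apply: val_inj => /=; case: (ltngtP i j) => // ij; rewrite (val_inj ij).
Qed.

Lemma upair_inj x y v w : upair x y = upair v w ->
  x = v /\ y = w \/ x = w /\ y = v.
Proof. by move=> [] /=; do 2!case: ifP => _; case=> -> ->; auto. Qed.

Lemma upair_injr x y w : upair x y = upair x w -> y = w.
Proof. by case/upair_inj => -[] // -> ->. Qed.

Lemma upair_surj (e : edge n) : exists i j, e = upair i j.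
Proof.
case: e => -[i j] ij; exists i, j; apply: val_inj => /=.
by rewrite /= in ij; rewrite ij.
Qed.

Lemma joined_upair (G : {set edge n}) i j : joined G i j = (upair i j \in G).
Proof.
apply/existsP/idP => [[e /andP[eG eij]]|eG].
  suff -> : upair i j = e by [].
  have [a [b eE]] := upair_surj e; move: eij; rewrite eE /=.
  case: ifP => _ /orP[]/eqP[<- <-] //; exact: upairC.
by exists (upair i j); rewrite eG /=; case: ifP; rewrite eqxx ?orbT.
Qed.

Lemma edge_prob_upair (R : realType) (p : 'M[R]_n) i j :
  (forall i j, p i j = p j i) -> edge_prob p (upair i j) = p i j.
Proof. by rewrite /edge_prob /= => psym; case: ifP => _ /=. Qed.

(** Loops count once in [deg]; the sets O used below contain none. *)
Definition deg O x := #|[set y | upair x y \in O]%SET|.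

Lemma deg_add_le O v w x :
  (deg (upair v w |: O) x <= deg O x + ((x == v) || (x == w)))%N.
Proof.
have sub1 z : (forall y, upair x y = upair v w -> y = z) ->
    (deg (upair v w |: O) x <= deg O x + 1)%N.
  move=> yz; rewrite addn1 -[X in (_ <= X)%N]add1n -(cards1 z).
  apply: leq_trans (leq_of_leqif (leq_card_setU _ _)).
  apply/subset_leq_card/fintype.subsetP => y; rewrite !inE.
  by case/orP=> [/eqP/yz ->|->]; rewrite ?eqxx ?orbT.
have [xE|xv] /= := eqVneq x v.
  by apply: (sub1 w) => y; rewrite xE => /upair_injr.
have [xE|xw] /= := eqVneq x w.
  by apply: (sub1 v) => y; rewrite xE [RHS]upairC => /upair_injr.
rewrite addn0; apply/subset_leq_card/fintype.subsetP => y; rewrite !inE.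
by case/orP=> // /eqP/upair_inj[] [] /eqP; rewrite ?(negPf xv) ?(negPf xw).
Qed.

Lemma deg_remove O v w x : upair v w \in O ->
  deg O x = (deg (O :\ upair v w) x + ((x == v) || (x == w)))%N.
Proof.
move=> vwO.
have sub1 z : upair x z = upair v w -> deg O x = (deg (O :\ upair v w) x + 1)%N.
  move=> xz; rewrite /deg (cardsD1 z) inE xz vwO addnC; congr (#|pred_of_set _| + _)%N.
  apply/finset.setP => y; rewrite !inE -xz; congr (~~ _ && _).
  by apply/eqP/eqP => [->|/upair_injr].
have [xE|xv] /= := eqVneq x v; first by apply: (sub1 w); rewrite xE.
have [xE|xw] /= := eqVneq x w; first by apply: (sub1 v); rewrite xE upairC.
rewrite addn0; apply: eq_card => y; rewrite !inE andb_idl // => _.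
by apply: contraNN xv => /eqP/upair_inj[] [/eqP]; rewrite ?(negPf xw).
Qed.

(** * The excess of a set of open edges *)

(** If the edges of O form a path ending at the current vertex v, then an inner
vertex has degree 2, and v has degree 1 or, if the path is trivial, 0: the
excess vanishes.  Counting v itself once corrects for the missing edge by
which the walk will leave v. *)
Definition excess O v := (\sum_x (deg O x + (x == v) - 2))%N.

Lemma excess_move O v w : (excess O w <= (excess O v).+1)%N.
Proof.
rewrite -addn1 -(_ : \sum_x (x == w) = 1)%N; last first.
  by rewrite (bigD1 w) //= eqxx big1 // => x /negPf ->.
rewrite -big_split /=; apply: leq_sum => x _.
by case: (x == w); case: (x == v); lia.
Qed.

Lemma excess_open O v w : deg O w = 0%N -> v != w ->
  (excess (upair v w |: O) w <= excess O v)%N.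
Proof.
move=> w0 vw; apply: leq_sum => x _; have := deg_add_le O v w x.
have [->|xv] := eqVneq x v; first by rewrite (negPf vw) /=; lia.
by have [->|xw] := eqVneq x w; rewrite /= ?w0; lia.
Qed.

(** A closing step that had a choice pays for it with one unit of excess. *)
Lemma excess_close O v w : upair v w \in O -> v != w ->
  (excess (O :\ upair v w) w + (1 < deg O v) <= excess O v)%N.
Proof.
move=> vwO vw; rewrite /excess (bigD1 v) //= [X in (_ <= X)%N](bigD1 v) //=.
rewrite addnAC leq_add //.
  by have := deg_remove v vwO; rewrite eqxx (negPf vw) /=; case: ltnP; lia.
apply: leq_sum => x xv; have := deg_remove x vwO; rewrite (negPf xv) /=.
by case: (x == w); lia.
Qed.

(** The number of closing steps is absorbed by the excess: it is 1 if the step is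
forced, and otherwise it is at most K while the excess drops. *)
Lemma sum_expn_excess_close K O v : (0 < K)%N -> (deg O v <= K)%N ->
  (forall w, upair v w \in O -> v != w) ->
  (\sum_(w | upair v w \in O) K ^ excess (O :\ upair v w) w <= K ^ excess O v)%N.
Proof.
move=> K0 vK loopless; set b : nat := (1 < deg O v)%N.
have step w : upair v w \in O ->
    (K ^ excess (O :\ upair v w) w <= K ^ (excess O v - b))%N.
  move=> vwO; rewrite leq_pexp2l // -(leq_add2r b).
  by have := excess_close vwO (loopless w vwO); rewrite -/b; lia.
apply: (@leq_trans (\sum_(w | upair v w \in O) K ^ (excess O v - b))%N).
  exact: leq_sum.
rewrite sum_nat_const (_ : #|_| = deg O v); last first.
  by apply: eq_card => w; rewrite !inE.
have [v0|v0] := posnP (deg O v); first by rewrite v0.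
have [w vwO] : exists w, upair v w \in O.
  by move: v0 => /card_gt0P[w]; rewrite inE; exists w.
have := excess_close vwO (loopless w vwO); rewrite -/b.
have [lt1|le1] := ltnP 1 (deg O v); rewrite /b.
  rewrite lt1 addn1 => ex1; rewrite subn1 -[in X in (_ <= X)%N](ltn_predK ex1) expnS.
  by rewrite leq_mul2r vK orbT.
rewrite ltnNge le1 /= subn0 => _.
by rewrite -[X in (_ <= X)%N]mul1n leq_mul2r le1 orbT.
Qed.

End UnorderedPairs.

(** * Expectations over the random graph *)

Section Moments.
Variables (R : realType) (n : nat) (p : 'M[R]_n).
Hypothesis p_sym : forall i j, p i j = p j i.
Hypothesis p_01 : forall i j, 0 <= p i j <= 1.
Implicit Types (v w x y : 'I_n) (V : {set 'I_n}) (O T G : {set edge n}).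

Definition expect (f : {set edge n} -> R) : R :=
  \sum_G graph_prob p G * f G.

Lemma expect_sum (I : finType) (f : I -> {set edge n} -> R) :
  expect (fun G => \sum_i f i G) = \sum_i expect (f i).
Proof.
by rewrite /expect exchange_big; apply: eq_bigr => G _; rewrite mulr_sumr.
Qed.

Lemma eq_expect f g : f =1 g -> expect f = expect g.
Proof. by move=> fg; apply: eq_bigr => G _; rewrite fg. Qed.

Lemma edge_prob_01 e : 0 <= edge_prob p e <= 1.
Proof. exact: p_01. Qed.

Lemma markov_inequality f (E : pred {set edge n}) a : 0 < a ->
  (forall G, 0 <= f G) -> (forall G, ~~ E G -> a <= f G) ->
  1 - expect f / a <= Pr p E.
Proof.
move=> a0 f0 fa; rewrite lerBlDr -(Pr_total p) /Pr.
rewrite (bigID E) /= lerD2l ler_pdivlMr // mulr_suml /expect.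
rewrite [leRHS](bigID E) /= -[leLHS]add0r lerD //.
  by apply: sumr_ge0 => G _; rewrite mulr_ge0 ?graph_prob_ge0.
by apply: ler_sum => G /fa; apply: ler_wpM2l; rewrite graph_prob_ge0.
Qed.

Definition centered_adj G : 'M[R]_n := adj G - p.

Definition centered_edge G e : R := (e \in G)%:R - edge_prob p e.

(** The m-th moment of a centered Bernoulli variable with parameter q. *)
Definition bernoulli_moment (q : R) m := q * (1 - q) ^+ m + (1 - q) * (- q) ^+ m.

Lemma centered_adjE G i j : centered_adj G i j = centered_edge G (upair i j).
Proof. by rewrite !mxE joined_upair /centered_edge edge_prob_upair. Qed.

(** Independence of the edges. *)
Lemma expect_monomial (M : edge n -> nat) :
  expect (fun G => \prod_e centered_edge G e ^+ M e)
    = \prod_e bernoulli_moment (edge_prob p e) (M e).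
Proof.
rewrite /bernoulli_moment bigA_distr; apply: eq_bigr => G _.
rewrite -big_split; apply: eq_bigr => e _.
by rewrite /centered_edge; case: (e \in G); rewrite ?sub0r.
Qed.

Lemma bernoulli_moment1 q : bernoulli_moment q 1 = 0.
Proof. by rewrite /bernoulli_moment; ring. Qed.

Lemma bernoulli_moment_le1 q m : 0 <= q <= 1 -> `|bernoulli_moment q m| <= 1.
Proof.
move=> /andP[q0 q1]; rewrite /bernoulli_moment.
apply: le_trans (ler_normD _ _) _.
rewrite !normrM !normrX normrN (ger0_norm q0) ger0_norm ?subr_ge0 //.
apply: (@le_trans _ _ (q * 1 + (1 - q) * 1)); last by rewrite !mulr1 addrC subrK.
apply: lerD; apply: ler_wpM2l; rewrite ?subr_ge0 //.
  by rewrite exprn_ile1 ?subr_ge0 // lerBlDr lerDl.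
by rewrite exprn_ile1.
Qed.

Lemma bernoulli_moment_le q m : 0 <= q <= 1 -> (0 < m)%N ->
  `|bernoulli_moment q m| <= q.
Proof.
case: m => [//|[|m]] /andP[q0 q1] _; first by rewrite bernoulli_moment1 normr0.
rewrite /bernoulli_moment.
apply: le_trans (ler_normD _ _) _.
rewrite normrM [X in _ + X]normrM !normrX normrN (ger0_norm q0) ger0_norm ?subr_ge0 //.
apply: (@le_trans _ _ (q * (1 - q) + (1 - q) * q ^+ 2)).
  apply: lerD; apply: ler_wpM2l; rewrite ?subr_ge0 //.
    by rewrite exprS ler_piMr ?subr_ge0 // exprn_ile1 ?subr_ge0 // lerBlDr lerDl.
  by rewrite -addn2 exprD ler_piMl ?exprn_ge0 // exprn_ile1.
nra.
Qed.

(** The total charge of the walks with j steps that start at v with discovered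
vertices V and open edges O, and that end with no open edge.  Only the
opening steps are charged. *)
Fixpoint walk_weight j V O v : R :=
  if j is j'.+1 then
    \sum_w (if w \notin V then p v w * walk_weight j' (w |: V) (upair v w |: O) w
            else if upair v w \in O then walk_weight j' V (O :\ upair v w) w
            else walk_weight j' V O w)
  else (O == finset.set0)%:R.

(** M records how often each edge was used so far and T the edges charged so
far.  The open edges were used exactly once, so a walk that leaves one of them
open contributes 0; the charged edges were used, so each of them contributes at
most its probability.  Both remain true along the recursion because an edge
leading to an undiscovered vertex is unused. *)
Lemma expect_walk_le j V O T (M : edge n -> nat) v u :
  v \in V ->
  (forall e, e \in O -> M e = 1%N) ->
  (forall e, e \in T -> (0 < M e)%N) ->
  (forall x y, (0 < M (upair x y))%N -> x \in V) ->
  `|expect (fun G => (\prod_e centered_edge G e ^+ M e) * (centered_adj G ^+ j) v u)|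
    <= (\prod_(e in T) edge_prob p e) * walk_weight j V O v.
Proof.
elim: j V O T M v => [|j IH] V O T M v vV OM TM MV.
  rewrite (@eq_expect _ (fun G => (\prod_e centered_edge G e ^+ M e)
      * (v == u)%:R)); last by move=> G; rewrite expr0 mxE.
  have -> : expect (fun G => (\prod_e centered_edge G e ^+ M e) * (v == u)%:R)
      = expect (fun G => \prod_e centered_edge G e ^+ M e) * (v == u)%:R.
    by rewrite /expect mulr_suml; apply: eq_bigr => G _; rewrite mulrA.
  rewrite expect_monomial normrM normr_nat.
  apply: (@le_trans _ _ (`|\prod_e bernoulli_moment (edge_prob p e) (M e)| * 1)).
    by rewrite ler_wpM2l //; case: eqP.
  rewrite mulr1 normr_prod /=.
  have [_|/finset.set0Pn[e eO]] := eqVneq O finset.set0; last first.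
    by rewrite (bigD1 e) //= OM // bernoulli_moment1 normr0 mul0r mulr0.
  rewrite mulr1 [leRHS]big_mkcond /=; apply: ler_prod => e _; rewrite normr_ge0 /=.
  case: ifP => eT; last exact: bernoulli_moment_le1 (edge_prob_01 e).
  exact: bernoulli_moment_le (edge_prob_01 e) (TM e eT).
(* The first step, to w, adds one factor to the monomial. *)
pose M' w e := (M e + (e == upair v w))%N.
rewrite (@eq_expect _ (fun G => \sum_w (\prod_e centered_edge G e ^+ M' w e)
    * (centered_adj G ^+ j) w u)); last first.
  move=> G; rewrite exprS mxE mulr_sumr; apply: eq_bigr => w _.
  rewrite mulrA centered_adjE; congr (_ * _).
  rewrite (bigD1 (upair v w)) //= [RHS](bigD1 (upair v w)) //=.
  rewrite /M' eqxx addn1 exprSr mulrAC; congr (_ * _).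
  by apply: eq_bigr => e /negPf ->; rewrite addn0.
rewrite expect_sum; apply: le_trans (ler_norm_sum _ _ _) _.
rewrite /= mulr_sumr; apply: ler_sum => w _.
have [wV|wV] /= := boolP (w \in V); last first.
  have M0 : M (upair v w) = 0%N.
    by apply/eqP; rewrite -leqn0 leqNgt; apply: contra wV; rewrite upairC => /MV.
  have eT : upair v w \notin T by apply/negP => /TM; rewrite M0.
  have eO : upair v w \notin O by apply/negP => /OM; rewrite M0.
  rewrite mulrA [_ * p v w]mulrC -(edge_prob_upair v w p_sym) -big_setU1 //=.
  apply: IH; first by rewrite !inE eqxx.
  - move=> e; rewrite !inE /M'; have [-> _|_ /= eO'] := eqVneq e (upair v w).
      by rewrite M0.
    by rewrite OM.
  - move=> e; rewrite !inE /M'; have [-> _|_ /= eT'] := eqVneq e (upair v w).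
      by rewrite M0.
    by rewrite addn0 TM.
  - move=> x y; rewrite /M' !inE; case: eqP => [/upair_inj[] [-> _] _|_].
    + by rewrite vV orbT.
    + by rewrite eqxx.
    by rewrite addn0 => /MV ->; rewrite orbT.
have M'V x y : (0 < M' w (upair x y))%N -> x \in V.
  by rewrite /M'; case: eqP => [/upair_inj[] [-> _]|_] //; rewrite addn0 => /MV.
have TM' e : e \in T -> (0 < M' w e)%N by move=> /TM; rewrite /M'; apply: ltn_addr.
case: ifPn => eO; apply: IH => // e.
  by rewrite !inE => /andP[/negPf ne eO']; rewrite /M' ne OM.
move=> eO'; rewrite /M' OM //; case: eqP => // eE.
by rewrite -eE eO' in eO.
Qed.

(** Without the excess this is the bound for weighted Motzkin paths by powers of
a tridiagonal matrix with constant diagonal K^2: the vector with entries s^-h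
is an eigenvector for 2 s + K^2, except that there is no step down from height
0; one s comes from opening and one from closing an edge. *)
Lemma walk_weight_le (s : R) K j V O v : 0 < s ->
  (forall x, \sum_y p x y <= s ^+ 2) ->
  v \in V -> (forall x y, upair x y \in O -> (x \in V) && (x != y)) ->
  (#|V| + j <= K)%N ->
  walk_weight j V O v <=
    K%:R ^+ excess O v * s ^- #|O| * (2 * s + K%:R ^+ 2) ^+ j.
Proof.
move=> s0 ps; elim: j V O v => [|j IH] V O v vV OV VK.
  rewrite expr0 mulr1 /=; have [->|_] := eqVneq O finset.set0; last first.
    by rewrite mulr_ge0 ?exprn_ge0 // invr_ge0 exprn_ge0 // ltW.
  rewrite cards0 expr0 invr1 mulr1 exprn_ege1 // ler1n.
  by apply: leq_trans VK; rewrite addn0; apply/card_gt0P; exists v.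
have K0 : (0 < K)%N by apply: leq_trans VK; rewrite addnS.
have cardV : (#|V| <= K)%N by apply: leq_trans VK; apply: leq_addr.
have K1 : 1 <= K%:R :> R by rewrite ler1n.
set C := 2 * s + K%:R ^+ 2.
have C0 : 0 <= C by rewrite addr_ge0 ?exprn_ge0 // mulr_ge0 // ltW.
set a := s ^- #|O|; set b : R := K%:R ^+ excess O v.
have s0' := ltW s0.
have a0 : 0 <= a by rewrite invr_ge0 exprn_ge0.
have b0 : 0 <= b by rewrite exprn_ge0.
have Cj0 : 0 <= C ^+ j by rewrite exprn_ge0.
have degV w : upair v w \in O -> w \in V by rewrite upairC => /OV/andP[].
(* Upper bounds, by the induction hypothesis, for a first step to w of each
   type. *)
pose opening w := p v w * (b * (a * s^-1) * C ^+ j).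
pose closing w := if upair v w \in O then
  K%:R ^+ excess (O :\ upair v w) w * (a * s) * C ^+ j else 0.
pose neutral w := if w \in V then K%:R * b * a * C ^+ j else 0.
apply: (@le_trans _ _ (\sum_w (opening w + closing w + neutral w))).
  apply: ler_sum => w _; have [pw _] := andP (p_01 v w).
  have op0 : 0 <= opening w.
    by rewrite !mulr_ge0 ?invr_ge0 ?exprn_ge0.
  have [wV|wV] /= := boolP (w \in V); last first.
    have eO : upair v w \notin O by apply: contra wV; apply: degV.
    rewrite /closing (negPf eO) /neutral (negPf wV) !addr0 ler_wpM2l //.
    have vw : v != w by apply: contraNneq wV => <-.
    apply: le_trans (IH _ _ _ _ _ _) _.
    - by rewrite !inE eqxx.
    - move=> x y; rewrite !inE => /orP[/eqP/upair_inj[] [-> ->]|/OV/andP[-> ->]].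
      + by rewrite vV vw orbT.
      + by rewrite eqxx eq_sym vw.
      + by rewrite orbT.
    - by rewrite cardsU1 wV add1n addSnnS.
    rewrite ler_wpM2r // cardsU1 eO add1n exprSr invfM [_^-1 * _]mulrC -/a.
    rewrite ler_wpM2r ?mulr_ge0 ?invr_ge0 ?exprn_ge0 //; apply: ler_weXn2l => //.
    apply: excess_open vw; apply/eqP; rewrite -leqn0 leqNgt.
    by apply: contra wV => /card_gt0P[y]; rewrite inE => /OV/andP[].
  have VKj : (#|V| + j <= K)%N by apply: leq_trans VK; rewrite addnS.
  have neutral0 : 0 <= neutral w.
    by rewrite /neutral; case: ifP => // _; rewrite !mulr_ge0.
  case: ifPn => eO.
    rewrite -[leLHS]add0r -[leLHS]addr0 lerD // lerD // /closing eO.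
    apply: le_trans (IH _ _ _ wV _ VKj) _.
      by move=> x y; rewrite !inE => /andP[_ /OV].
    rewrite ler_wpM2r // ler_wpM2l ?exprn_ge0 // /a (cardsD1 (upair v w) O) eO.
    by rewrite add1n exprSr invfM -mulrA mulVf ?mulr1 // gt_eqF.
  rewrite -[leLHS]add0r lerD ?addr_ge0 //.
    by rewrite /closing (negPf eO).
  rewrite /neutral wV; apply: le_trans (IH _ _ _ wV OV VKj) _.
  rewrite ler_wpM2r // ler_wpM2r // -exprS; apply: ler_weXn2l => //.
  exact: excess_move.
rewrite !big_split /= exprS.
have -> : b * a * (C * C ^+ j) =
    s ^+ 2 * (b * (a * s^-1) * C ^+ j) + b * (a * s) * C ^+ j
    + K%:R * (K%:R * b * a * C ^+ j).
  by rewrite /C; field; rewrite gt_eqF.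
apply: lerD; first apply: lerD.
- by rewrite -mulr_suml ler_wpM2r // !mulr_ge0 ?invr_ge0 ?exprn_ge0.
- rewrite /closing -big_mkcond -!mulr_suml /= ler_wpM2r // ler_wpM2r ?mulr_ge0 //.
  rewrite (eq_bigr (fun w => (K ^ excess (O :\ upair v w) w)%:R)); last first.
    by move=> w _; rewrite natrX.
  rewrite -natr_sum /b -natrX ler_nat sum_expn_excess_close //.
    apply: leq_trans cardV; apply/subset_leq_card/fintype.subsetP => w.
    by rewrite inE => /degV.
  by move=> w /OV/andP[].
rewrite /neutral -big_mkcond sumr_const -[leLHS]mulr_natl ler_wpM2r ?ler_nat //.
by rewrite !mulr_ge0.
Qed.

(** The initial state, with one vertex and no open edge, has excess 0. *)
Lemma expect_trace_le (s : R) k : 0 < s -> (forall x, \sum_y p x y <= s ^+ 2) ->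
  expect (fun G => \tr (centered_adj G ^+ k))
    <= n%:R * (2 * s + k.+1%:R ^+ 2) ^+ k.
Proof.
move=> s0 ps; rewrite expect_sum -[n in n%:R]card_ord mulr_natl -sumr_const.
apply: ler_sum => v _.
apply: le_trans (ler_norm _) _.
rewrite (@eq_expect _ (fun G => (\prod_e centered_edge G e ^+ 0)
    * (centered_adj G ^+ k) v v)); last by move=> G; rewrite big1 ?mul1r.
apply: le_trans (@expect_walk_le k [set v]%SET finset.set0 finset.set0
  (fun=> 0%N) v v _ _ _ _) _ => //; try by move=> e; rewrite inE.
  by rewrite inE.
rewrite big_set0 mul1r.
apply: le_trans (@walk_weight_le s k.+1 _ _ _ _ s0 ps _ _ _) _.
- by rewrite inE.
- by move=> x y; rewrite inE.
- by rewrite cards1.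
rewrite cards0 expr0 invr1 mulr1 (_ : excess _ _ = 0%N) ?mul1r //.
rewrite /excess big1 // => x _; rewrite (_ : deg _ _ = 0%N).
  by case: eqP.
by apply: eq_card0 => y; rewrite !inE.
Qed.

End Moments.

(** * Concentration of the spectrum *)

Section Concentration.
Variables (R : realType) (n : nat) (p : 'M[R]_n).
Hypothesis p_sym : forall i j, p i j = p j i.
Hypothesis p_01 : forall i j, 0 <= p i j <= 1.

Lemma Pr_le1 (E : pred {set edge n}) : Pr p E <= 1.
Proof.
rewrite -(Pr_total p) /Pr [leRHS](bigID E) /= lerDl.
by apply: sumr_ge0 => G _; apply: graph_prob_ge0.
Qed.

Definition close_spectrum (rho : R) : pred {set edge n} :=
  fun G => [forall i : 'I_n, `|eigval (adj G) i - eigval p i| <= rho].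

(** Weyl's inequality and Markov's inequality for the trace of the k-th power. *)
Lemma Pr_close_spectrum_ge (s rho : R) k :
  0 < s -> 0 < rho -> ~~ odd k -> (forall i, \sum_j p i j <= s ^+ 2) ->
  1 - n%:R * ((2 * s + k.+1%:R ^+ 2) / rho) ^+ k <= Pr p (close_spectrum rho).
Proof.
move=> s0 rho0 k_even ps.
have p_trmx : p^T = p by apply/matrixP => i j; rewrite mxE.
have adj_trmx G : (adj G)^T = adj G :> 'M[R]_n.
  by apply/matrixP => i j; rewrite !mxE !joined_upair upairC.
have X_trmx G : (centered_adj p G)^T = centered_adj p G.
  by rewrite linearB /= adj_trmx p_trmx.
have rhok0 : 0 < rho ^+ k by rewrite exprn_gt0.
apply: le_trans (@markov_inequality _ _ _ p_01
  (fun G => \tr (centered_adj p G ^+ k)) _ _ rhok0 _ _).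
- rewrite lerD2l lerN2 exprMn exprVn mulrA ler_wpM2r ?invr_ge0 ?(ltW rhok0) //.
  exact: expect_trace_le.
- move=> G; rewrite mxtrace_exp_eigval //.
  by apply: sumr_ge0 => i _; rewrite exprn_even_ge0.
move=> G far; have [i rho_lt] : exists i, rho < `|eigval (centered_adj p G) i|.
  apply/existsP; apply: contraNT far => /existsPn le_rho.
  apply/forallP; apply: weyl_perturbation => // j.
  by rewrite leNgt.
apply: le_trans (eigval_exp_le_trace i (X_trmx G) k_even).
rewrite -[leRHS]ger0_norm ?exprn_even_ge0 // normrX.
by rewrite lerXn2r ?nnegrE ?normr_ge0 // ltW.
Qed.

Lemma row_sum_le_max_degree i : \sum_j p i j <= max_degree p.
Proof. exact: (le_bigmax _ (fun i => \sum_j p i j)). Qed.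

(** The error term, in terms of u = (ln^4 n / Delta)^(1/8). *)
Definition slack (u : R) := (2 + 25 * u ^+ 2) * expR u - 2.

(** Put L = ln n and s = b^4 L^2, the square root of the maximum degree.  With k
about 2 b L, on the one hand (k+1)^2 <= 25 b^2 L^2 = 25 s / b^2, which is o(s);
on the other hand, enlarging the threshold by a factor e^(1/b) gains
e^(- k/b) <= n^-2, which beats the factor n. *)
Lemma Pr_close_spectrum_ln (b : R) : 1 <= b -> 1 <= ln (n%:R : R) ->
  max_degree p = b ^+ 8 * ln n%:R ^+ 4 ->
  1 - n%:R^-1 <= Pr p (close_spectrum ((2 + slack b^-1) * Num.sqrt (max_degree p))).
Proof.
move=> b1 L1 DE; set L : R := ln n%:R in L1 DE.
have b0 : 0 < b by apply: lt_le_trans b1.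
have L0 : 0 < L by apply: lt_le_trans L1.
have n0 : (0 < n)%N.
  by rewrite lt0n; apply: contraTneq L1 => n0; rewrite /L n0 ln0 // ler10.
pose s := b ^+ 4 * L ^+ 2.
have s0 : 0 < s by rewrite mulr_gt0 ?exprn_gt0.
have D_s2 : max_degree p = s ^+ 2 by rewrite DE /s; ring.
rewrite D_s2 sqrtr_sqr gtr0_norm //.
pose t := Num.trunc (b * L); pose k := (t.+1).*2.
have tle : t%:R <= b * L by rewrite /t truncn_le mulr_ge0 // ltW.
have tge : b * L <= t.+1%:R by rewrite /t ltW // truncnS_gt.
have kle : k.+1%:R ^+ 2 <= 25 * b^-1 ^+ 2 * s.
  have -> : 25 * b^-1 ^+ 2 * s = (5 * (b * L)) ^+ 2.
    by rewrite /s; field; rewrite gt_eqF.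
  have bL1 : 1 <= b * L by rewrite mulr_ege1.
  rewrite lerXn2r ?nnegrE ?mulr_ge0 ?(ltW b0) ?(ltW L0) //.
  have -> : k.+1%:R = 2 * t%:R + 3 :> R.
    by rewrite /k -mul2n -natr1 natrM -natr1; ring.
  lra.
set rho := _ * s.
have rhoE : rho = (2 + 25 * b^-1 ^+ 2) * s * expR b^-1.
  by rewrite /rho /slack; ring.
have base0 : 0 < (2 + 25 * b^-1 ^+ 2) * s.
  by rewrite mulr_gt0 // ltr_wpDr // mulr_ge0 // exprn_ge0 // invr_ge0 ltW.
have rho0 : 0 < rho by rewrite rhoE mulr_gt0 ?expR_gt0.
apply: le_trans (@Pr_close_spectrum_ge s rho k s0 rho0 _ _); last first.
- by move=> i; rewrite -D_s2 row_sum_le_max_degree.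
- by rewrite odd_double.
rewrite lerD2l lerN2.
have ratio : (2 * s + k.+1%:R ^+ 2) / rho <= expR (- b^-1).
  rewrite ler_pdivrMr // rhoE [leRHS]mulrCA -expRD addNr expR0 mulr1.
  by rewrite [leRHS]mulrDl lerD2l.
apply: (@le_trans _ _ (n%:R * expR (- b^-1) ^+ k)).
  rewrite ler_wpM2l // lerXn2r ?nnegrE ?expR_ge0 //.
  by rewrite divr_ge0 ?ltW // addr_gt0 ?mulr_gt0 ?exprn_gt0.
rewrite -expRM_natl.
apply: (@le_trans _ _ (n%:R * expR (- (2 * L)))).
  rewrite ler_wpM2l // ler_expR mulrN lerN2 ler_pdivlMr //.
  by rewrite /k -mul2n natrM; lra.
have nE : n%:R = expR L by rewrite lnK // posrE ltr0n.
by rewrite nE -expRD -expRN ler_expR; lra.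
Qed.

End Concentration.

(** * Asymptotics *)

Lemma cvgy_sqrt (R : realType) (u : nat -> R) :
  u n @[n --> \oo] --> +oo -> Num.sqrt (u n) @[n --> \oo] --> +oo.
Proof.
move=> /cvgryPge uy; apply/cvgryPge => A.
apply: filterS (uy (A ^+ 2)) => n Au.
by apply: le_trans (ler_norm A) _; rewrite -sqrtr_sqr ler_wsqrtr.
Qed.

Lemma slack_cvg0 (R : realType) (u : nat -> R) :
  u n @[n --> \oo] --> (0 : R) -> slack (u n) @[n --> \oo] --> (0 : R).
Proof.
move=> u0; rewrite (_ : 0 = (2 + 25 * 0 ^+ 2) * expR 0 - 2 :> R); last first.
  by rewrite expR0 expr0n /=; ring.
apply: cvgB; last exact: cvg_cst.
apply: cvgM; last first.
  by apply: continuous_cvg => //; apply: continuous_expR.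
apply: cvgD; first exact: cvg_cst.
apply: cvgM; first exact: cvg_cst.
rewrite expr2; under eq_fun do rewrite expr2; exact: cvgM.
Qed.

Theorem theorem1 (R : realType) (p : forall n : nat, 'M[R]_n)
    (p_sym : forall n (i j : 'I_n), p n i j = p n j i)
    (p_01 : forall n (i j : 'I_n), 0 <= p n i j <= 1)
    (Delta_large : max_degree (p n) / ln (n%:R : R) ^+ 4 @[n --> \oo] --> +oo) :
  exists2 eps : nat -> R, eps n @[n --> \oo] --> (0 : R) &
    Pr (p n) (fun G => [forall i : 'I_n,
        `|eigval (adj G) i - eigval (p n) i|
          <= (2 + eps n) * Num.sqrt (max_degree (p n))]) @[n --> \oo] --> (1 : R).
Proof.
pose r n := max_degree (p n) / ln (n%:R : R) ^+ 4.
pose b n := Num.sqrt (Num.sqrt (Num.sqrt (r n))).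
have b_oo : b n @[n --> \oo] --> +oo by do 3!apply: cvgy_sqrt.
have b1 : \forall n \near \oo, 1 <= b n by apply: (cvgryPge b).1.
exists (fun n => slack (b n)^-1).
  apply: slack_cvg0; apply/gtr0_cvgV0 => //.
  by apply: filterS b1 => n; apply: lt_le_trans.
have inv_n : (n%:R : R)^-1 @[n --> \oo] --> (0 : R).
  apply/gtr0_cvgV0; last exact/cvgryPge/nbhs_infty_ger.
  by exists 1%N => // n /= n1; rewrite ltr0n.
apply: (@squeeze_cvgr _ _ _ _ (fun n => 1 - n%:R^-1) (fun=> 1)); last first.
- exact: cvg_cst.
- by rewrite -[X in _ --> X]subr0; apply: cvgB => //; exact: cvg_cst.
have ln1 : \forall n \near \oo, 1 <= ln (n%:R : R).
  apply: filterS (nbhs_infty_ger (expR (1 : R))) => n en.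
  have n0 : 0 < n%:R :> R by apply: lt_le_trans en; apply: expR_gt0.
  by rewrite -[leLHS]expRK ler_ln ?posrE ?expR_gt0.
apply: filterS2 b1 ln1 => n b1 L1; rewrite Pr_le1 // andbT.
apply: Pr_close_spectrum_ln => //.
have r0 : 0 <= r n.
  rewrite leNgt; apply: contraL b1 => /ltW r0.
  by rewrite /b (ler0_sqrtr r0) !sqrtr0 ler10.
rewrite (_ : b n ^+ 8 = r n) /r ?divfK // ?gt_eqF ?exprn_gt0 ?(lt_le_trans ltr01) //.
by rewrite -[8%N]/(2 * 2 * 2)%N !exprM !sqr_sqrtr ?sqrtr_ge0.
Qed.
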